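(* Every infinite computable tree has a nontrivial self-embedding that is computable from $0''$.
   Context: A tree is a partial order $(T,\preceq)$ with a least element (the root) such that for every $n\in T$ the set $\{m\in T: m\preceq n\}$ is finite and linearly ordered; all trees are countable. A tree is computable if $T\subseteq\omega$ is computable and $\preceq$ is a computable relation on $T^2$. An embedding between trees is an injective map $f$ with $n\preceq m$ iff $f(n)\preceq f(m)$. A self-embedding $f:T\to T$ is nontrivial if it is not onto. $0''$ denotes the second Turing jump of a computable set. *)

(* Defs.v *)
From Stdlib Require Cantor.
From mathcomp Require Import all_boot.
From mathcomp Require Import boolp classical_sets functions cardinality.

Set Implicit Arguments.
Unset Strict Implicit.
Unset Printing Implicit Defensive.

Local Open Scope classical_set_scope.

(** * Oracle computability *)

Definition pairn (a b : nat) : nat := Cantor.to_nat (a, b).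
Definition fstn (n : nat) : nat := (Cantor.of_nat n).1.
Definition sndn (n : nat) : nat := (Cantor.of_nat n).2.

Lemma fstn_pairn a b : fstn (pairn a b) = a.
Proof. by rewrite /fstn /pairn Cantor.cancel_of_to. Qed.

Lemma sndn_pairn a b : sndn (pairn a b) = b.
Proof. by rewrite /sndn /pairn Cantor.cancel_of_to. Qed.

(** Programs for unary partial functions, several arguments being packed with
    [pairn]. The identity is [Tuple Fst Snd]. *)
Inductive code : Type :=
| Zero | Succ | Fst | Snd
| Query
| Tuple of code & code
| Comp of code & code
| Prec of code & code
| Mu of code.

(** [eval A c x y] : the program [c] with oracle [A] halts on input [x] with
    output [y].
    - [Prec c d] is primitive recursion, g(a,0) = c(a) and
      g(a,k+1) = d(a,(k,g(a,k)));
    - [Mu c] is unbounded search: the least y with c(x,y) = 0, the values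
      c(x,k) for k < y being defined and nonzero. *)
Fixpoint eval (A : set nat) (c : code) (x y : nat) {struct c} : Prop :=
  match c with
  | Zero => y = 0
  | Succ => y = x.+1
  | Fst => y = fstn x
  | Snd => y = sndn x
  | Query => y = `[< A x >]
  | Tuple c d => exists u v, [/\ eval A c x u, eval A d x v & y = pairn u v]
  | Comp c d => exists2 u, eval A d x u & eval A c u y
  | Prec c d =>
      nat_rect (fun=> nat -> Prop)
        (eval A c (fstn x))
        (fun k val z =>
           exists2 r, val r & eval A d (pairn (fstn x) (pairn k r)) z)
        (sndn x) y
  | Mu c =>
      eval A c (pairn x y) 0 /\
      (forall k, k < y -> exists v, eval A c (pairn x k) v.+1)
  end.

Lemma eval_functional A c x y z : eval A c x y -> eval A c x z -> y = z.
Proof.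
elim: c x y z => [||||| c IHc d IHd | c IHc d IHd | c IHc d IHd | c IHc] x y z.
1-5: by move=> /= -> ->.
- by case=> u [v [cu dv ->]] [u' [v' [/(IHc _ _ _ cu)-> /(IHd _ _ _ dv)-> ->]]].
- by case=> u du cu [u' /(IHd _ _ _ du)<-]; apply: IHc.
- move=> /=; elim: (sndn x) y z => [y z | k IHk y z] /=; first exact: IHc.
  by case=> r kr dr [r' /(IHk _ _ kr)<-]; apply: IHd.
- case=> cy miny [cz minz]; case: (ltngtP y z) => // [yz | zy].
    by have [v cv] := minz _ yz; have := IHc _ _ _ cy cv.
  by have [v cv] := miny _ zy; have := IHc _ _ _ cz cv.
Qed.

(** Goedel numbering of programs. It is not surjective: a number that codes no
    program indexes the nowhere defined function. *)
Fixpoint goedel (c : code) : nat :=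
  match c with
  | Zero => pairn 0 0
  | Succ => pairn 1 0
  | Fst => pairn 2 0
  | Snd => pairn 3 0
  | Query => pairn 4 0
  | Tuple c d => pairn 5 (pairn (goedel c) (goedel d))
  | Comp c d => pairn 6 (pairn (goedel c) (goedel d))
  | Prec c d => pairn 7 (pairn (goedel c) (goedel d))
  | Mu c => pairn 8 (goedel c)
  end.

Lemma pairn_inj a b a' b' : pairn a b = pairn a' b' -> a = a' /\ b = b'.
Proof.
move=> e; split; first by rewrite -(fstn_pairn a b) e fstn_pairn.
by rewrite -(sndn_pairn a b) e sndn_pairn.
Qed.

Lemma goedel_inj : injective goedel.
Proof.
elim=> [||||| c IHc d IHd | c IHc d IHd | c IHc d IHd | c IHc]
  [||||| c' d' | c' d' | c' d' | c'] /pairn_inj[] //= _.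
1-3: by move=> /pairn_inj[/IHc-> /IHd->].
by move=> /IHc->.
Qed.

(** [Phi A e x y] : the [e]-th partial [A]-computable function maps [x] to
    [y]. *)
Definition Phi (A : set nat) (e x y : nat) : Prop :=
  exists2 c, goedel c = e & eval A c x y.

Definition jump (A : set nat) : set nat := [set e | exists y, Phi A e e y].

(** [f] is only constrained on [D]. *)
Definition computable_fun_in (A D : set nat) (f : nat -> nat) : Prop :=
  exists e, forall n, D n -> Phi A e n (f n).

Definition computable_set_in (A B : set nat) : Prop :=
  computable_fun_in A setT (fun n => `[< B n >]).

Definition computable_set (B : set nat) : Prop := computable_set_in set0 B.

Definition zero_jump2 : set nat := jump (jump set0).

(** * Trees *)

Record is_tree (T : set nat) (le : nat -> nat -> Prop) : Prop := IsTree {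
  tree_refl : forall n, T n -> le n n;
  tree_antisym : forall m n, T m -> T n -> le m n -> le n m -> m = n;
  tree_trans : forall m n p, T m -> T n -> T p -> le m n -> le n p -> le m p;
  tree_root : exists2 r, T r & forall n, T n -> le r n;
  tree_finite : forall n, T n -> finite_set [set m | T m /\ le m n];
  tree_linear : forall n m p, T n -> T m -> T p ->
    le m n -> le p n -> le m p \/ le p m
}.

Record computable_tree (T : set nat) (le : nat -> nat -> Prop) : Prop :=
  ComputableTree {
  computable_tree_tree : is_tree T le;
  computable_tree_dom : computable_set T;
  computable_tree_le :
    computable_set [set k | exists m n, [/\ k = pairn m n, T m, T n & le m n]]
}.

Definition self_embedding (T : set nat) (le : nat -> nat -> Prop)
    (f : nat -> nat) : Prop :=
  [/\ set_fun T T f, set_inj T f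
    & forall m n, T m -> T n -> (le m n <-> le (f m) (f n))].

Definition nontrivial (T : set nat) (f : nat -> nat) : Prop :=
  ~ set_surj T T f.

(* Main.v *)
Require Import Defs.
From mathcomp Require Import all_boot.
From mathcomp Require Import boolp classical_sets functions cardinality.

(** Call a node infinite if infinitely many nodes lie above it; this property
    is decidable in 0''.

    If above every infinite node there are two incomparable infinite nodes, then
    above every infinite node [x] there is an infinite antichain [h x 0],
    [h x 1], ... of infinite nodes, and mapping each child [n] of [p] to
    [h (f p) n] embeds the whole tree strictly above the root.

    Otherwise the infinite nodes above some infinite node form a chain. Either
    some node has infinitely many children that are not infinite, and we list
    these children as s_0, s_1, ...; or we let s_0 < s_1 < ... be the infinite
    nodes of that chain. In both cases the blocks
    [{z | s_k <= z and not s_{k+1} <= z}] are finite trees. By Kruskal's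
    theorem, after discarding finitely many of them each block embeds into
    infinitely many others, root to root. The self-embedding sends block k into
    block g(k), for a strictly increasing g with g(k) > k, and fixes the other
    nodes. *)

Set Implicit Arguments.
Unset Strict Implicit.
Unset Printing Implicit Defensive.

(** * Oracle computability *)

Lemma pairn_surj x : pairn (fstn x) (sndn x) = x.
Proof.
by rewrite /pairn /fstn /sndn -surjective_pairing Cantor.cancel_to_of.
Qed.

Lemma ex_least (P : nat -> Prop) :
  (exists n, P n) -> exists n, P n /\ forall m, m < n -> ~ P m.
Proof.
case=> n; elim/ltn_ind: n => n IH Pn.
case: (pselect (exists2 m, m < n & P m)) => [[m mn Pm]|no]; first exact: IH Pm.
by exists n; split=> // m mn Pm; apply: no; exists m.
Qed.

(** Total functions, witnessed by a program rather than by an index; Goedel numbers enter only with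
    the jump and in the final statement. *)
Definition rec (A : set nat) (F : nat -> nat) : Prop :=
  exists c, forall x, eval A c x (F x).

Definition dec (A : set nat) (P : nat -> Prop) : Prop :=
  rec A (fun x => `[< P x >]).

(** * Closure properties of total computable functions *)

Section Closure.
Variable A : set nat.

Lemma rec_ext F G : (forall x, F x = G x) -> rec A F -> rec A G.
Proof. by move=> FG [c cF]; exists c => x; rewrite -FG. Qed.

Lemma dec_ext P Q : (forall x, P x <-> Q x) -> dec A P -> dec A Q.
Proof.
by move=> PQ; apply: rec_ext => x; congr nat_of_bool; apply: asbool_equiv_eq.
Qed.

Lemma rec_fst F : rec A F -> rec A (fun x => fstn (F x)).
Proof. by case=> c cF; exists (Comp Fst c) => x; exists (F x). Qed.

Lemma rec_snd F : rec A F -> rec A (fun x => sndn (F x)).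
Proof. by case=> c cF; exists (Comp Snd c) => x; exists (F x). Qed.

Lemma rec_S F : rec A F -> rec A (fun x => (F x).+1).
Proof. by case=> c cF; exists (Comp Succ c) => x; exists (F x). Qed.

Lemma rec_pair F G : rec A F -> rec A G -> rec A (fun x => pairn (F x) (G x)).
Proof.
by case=> c cF [d dG]; exists (Defs.Tuple c d) => x; exists (F x), (G x).
Qed.

Lemma rec_id : rec A (fun x => x).
Proof.
by exists (Defs.Tuple Fst Snd) => x; exists (fstn x), (sndn x); rewrite pairn_surj.
Qed.

Lemma rec_app F G : rec A F -> rec A G -> rec A (fun x => F (G x)).
Proof. by case=> c cF [d dG]; exists (Comp c d) => x; exists (G x). Qed.

Lemma dec_app P G : dec A P -> rec A G -> dec A (fun x => P (G x)).
Proof. exact: (@rec_app (fun x => `[< P x >])). Qed.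

Lemma rec_app2 (F : nat -> nat -> nat) G H :
  rec A (fun x => F (fstn x) (sndn x)) -> rec A G -> rec A H ->
  rec A (fun x => F (G x) (H x)).
Proof.
move=> cF cG cH; apply: rec_ext (rec_app cF (rec_pair cG cH)) => x.
by rewrite fstn_pairn sndn_pairn.
Qed.

Lemma dec_app2 (P : nat -> nat -> Prop) G H :
  dec A (fun x => P (fstn x) (sndn x)) -> rec A G -> rec A H ->
  dec A (fun x => P (G x) (H x)).
Proof. exact: (@rec_app2 (fun x y => `[< P x y >])). Qed.

Lemma rec_const n : rec A (fun=> n).
Proof. by elim: n => [|n IH]; [exists Zero | apply: rec_S]. Qed.

Lemma rec_nat_rect (c : nat -> nat) (d : nat -> nat -> nat -> nat) F G :
  rec A c ->
  rec A (fun x => d (fstn x) (fstn (sndn x)) (sndn (sndn x))) ->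
  rec A F -> rec A G ->
  rec A (fun x => nat_rect (fun=> nat) (c (F x)) (d (F x)) (G x)).
Proof.
case=> ec ecP [ed edP] cF cG.
apply: (@rec_app2 (fun a b => nat_rect (fun=> nat) (c a) (d a) b)) => //.
exists (Prec ec ed) => x /=; elim: (sndn x) => [|k IH] //=.
eexists; first exact: IH.
set r := nat_rect _ _ _ k; by have := edP (pairn (fstn x) (pairn k r));
  rewrite !(fstn_pairn, sndn_pairn).
Qed.

Lemma rec_iter f F G : rec A f -> rec A F -> rec A G ->
  rec A (fun x => iter (F x) f (G x)).
Proof.
move=> cf cF cG.
apply: rec_ext (@rec_nat_rect id (fun _ _ r => f r) G F rec_id _ cG cF) => [x|].
  by elim: (F x) => [|k IH] //=; rewrite IH.
by apply: rec_app cf _; do 2!apply: rec_snd; apply: rec_id.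
Qed.

(** The truth value of the test is the number of rounds of a primitive recursion: no round returns
    [G x], one round returns [F x]. *)
Lemma rec_if P F G : dec A P -> rec A F -> rec A G ->
  rec A (fun x => if `[< P x >] then F x else G x).
Proof.
move=> dP cF cG.
apply: rec_ext (@rec_nat_rect G (fun x _ _ => F x) id (fun x => `[< P x >])
  cG _ rec_id dP) => [x|].
  by case: `[< P x >].
by apply: rec_app cF _; apply: rec_fst; apply: rec_id.
Qed.

Lemma dec_not P : dec A P -> dec A (fun x => ~ P x).
Proof.
move=> dP; apply: rec_ext (rec_if dP (rec_const 0) (rec_const 1)) => x.
by rewrite asbool_neg; case: `[< P x >].
Qed.

Lemma dec_and P Q : dec A P -> dec A Q -> dec A (fun x => P x /\ Q x).
Proof.
move=> dP dQ; apply: rec_ext (rec_if dP dQ (rec_const 0)) => x.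
by rewrite asbool_and; case: `[< P x >].
Qed.

Lemma dec_or P Q : dec A P -> dec A Q -> dec A (fun x => P x \/ Q x).
Proof.
move=> dP dQ; apply: rec_ext (rec_if dP (rec_const 1) dQ) => x.
by rewrite asbool_or; case: `[< P x >].
Qed.

Lemma dec_imp P Q : dec A P -> dec A Q -> dec A (fun x => P x -> Q x).
Proof.
move=> dP dQ; apply: dec_ext (dec_or (dec_not dP) dQ) => x.
by split; [case | rewrite -implyE].
Qed.

Lemma dec_iff P Q : dec A P -> dec A Q -> dec A (fun x => P x <-> Q x).
Proof. by move=> dP dQ; apply: dec_and; apply: dec_imp. Qed.

Lemma dec_eq0 F : rec A F -> dec A (fun x => F x = 0).
Proof.
move=> cF.
apply: rec_ext (@rec_nat_rect (fun=> 1) (fun _ _ _ => 0) F F _ _ cF cF) => [x||];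
  try exact: rec_const.
by case: (F x) => [|n] /=; [rewrite asboolT | rewrite asboolF].
Qed.

Lemma rec_pred F : rec A F -> rec A (fun x => (F x).-1).
Proof.
move=> cF.
apply: rec_ext (@rec_nat_rect (fun=> 0) (fun _ k _ => k) F F _ _ cF cF) => [x||].
- by case: (F x).
- exact: rec_const.
- by apply: rec_fst; apply: rec_snd; apply: rec_id.
Qed.

Lemma rec_sub F G : rec A F -> rec A G -> rec A (fun x => F x - G x).
Proof.
move=> cF cG.
apply: rec_ext (rec_iter (rec_pred rec_id) cG cF) => x.
by elim: (G x) => [|k IH]; rewrite ?subn0 //= IH subnS.
Qed.

Lemma dec_le F G : rec A F -> rec A G -> dec A (fun x => F x <= G x).
Proof.
move=> cF cG; apply: dec_ext (dec_eq0 (rec_sub cF cG)) => x.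
by rewrite -subn_eq0; split=> [->|/eqP].
Qed.

Lemma dec_lt F G : rec A F -> rec A G -> dec A (fun x => F x < G x).
Proof. by move=> cF cG; apply: dec_le => //; apply: rec_S. Qed.

Lemma dec_eq F G : rec A F -> rec A G -> dec A (fun x => F x = G x).
Proof.
move=> cF cG; apply: dec_ext (dec_and (dec_le cF cG) (dec_le cG cF)) => x.
by split=> [[? ?]|->] //; apply/eqP; rewrite eqn_leq; apply/andP.
Qed.

(** [Mu] looks for a zero, so it is run on the negation of [P]. Minimality of the value found is
    recorded because some later searches rely on it. *)
Lemma rec_choose (P : nat -> nat -> Prop) :
  dec A (fun p => P (fstn p) (sndn p)) -> (forall x, exists y, P x y) ->
  exists F, [/\ rec A F, forall x, P x (F x)
                & forall x y, y < F x -> ~ P x y].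
Proof.
move=> /dec_not [c cP] /(_ _)/ex_least/cid-/all_sig[F FP].
exists F; split=> [|x|x]; try by have [] := FP x.
exists (Mu c) => x; have [Px Pmin] := FP x; split=> [|k /Pmin nP].
  by have := cP (pairn x (F x)); rewrite fstn_pairn sndn_pairn asboolF //; apply.
by exists 0; have := cP (pairn x k); rewrite fstn_pairn sndn_pairn asboolT.
Qed.

End Closure.

(** * Quantifiers and the jump *)

Fixpoint const_code (n : nat) : code :=
  if n is k.+1 then Comp Succ (const_code k) else Zero.

Lemma eval_const_code A n x y : eval A (const_code n) x y <-> y = n.
Proof.
elim: n y => [|n IH] y //=; split=> [[u /IH-> ->]|->] //.
by exists n => //; apply/IH.
Qed.

Lemma rec_goedel_const A : rec A (fun n => goedel (const_code n)).
Proof.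
apply: rec_ext (rec_iter (f := fun r => pairn 6 (pairn (goedel Succ) r)) _
  (rec_id A) (rec_const A (goedel Zero))).
  by elim=> [|n IH] //=; rewrite -IH.
apply: rec_pair (rec_const A 6) _.
exact: rec_pair (rec_const A _) (rec_id A).
Qed.

(* The s-m-n function is explicit here: the program that ignores its input and
   searches for a witness of [P x] is [Comp (Mu c) (const_code x)]. *)
Lemma dec_ex A (P : nat -> nat -> Prop) :
  dec A (fun p => P (fstn p) (sndn p)) ->
  dec (jump A) (fun x => exists y, P x y).
Proof.
move=> /dec_not [c cP].
have dJ : dec (jump A) (jump A) by exists Query.
have cs : rec (jump A) (fun x => goedel (Comp (Mu c) (const_code x))).
  apply: rec_pair (rec_const _ 6) _.
  exact: rec_pair (rec_const _ (goedel (Mu c))) (rec_goedel_const _).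
apply: dec_ext (dec_app dJ cs) => x.
have cPx y : eval A c (pairn x y) `[< ~ P x y >].
  by have := cP (pairn x y); rewrite fstn_pairn sndn_pairn.
split=> [[y [e /goedel_inj-> [_ /eval_const_code-> [cy _]]]]|].
  exists y; have := eval_functional cy (cPx y).
  by case: asboolP => // nn _; apply: contrapT.
move=> /ex_least[y [Py ymin]]; exists y, (Comp (Mu c) (const_code x)) => //.
exists x; first exact/eval_const_code.
split; first by have := cPx y; rewrite asboolF //; apply.
by move=> k /ymin nP; exists 0; have := cPx k; rewrite asboolT.
Qed.

Lemma dec_all A (P : nat -> nat -> Prop) :
  dec A (fun p => P (fstn p) (sndn p)) ->
  dec (jump A) (fun x => forall y, P x y).
Proof.
move=> dP; apply: dec_ext (dec_not (dec_ex (P := fun x y => ~ P x y) (dec_not dP))) => x.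
by rewrite -forallNP; split=> H y; [apply: contrapT | move/(_ (H y))].
Qed.

Lemma dec_jump A P : dec A P -> dec (jump A) P.
Proof.
move=> dP; apply: dec_ext (dec_ex (P := fun x _ => P x) _) => [x|].
  by split=> [[]|Px] //; exists 0.
by apply: dec_app dP _; apply: rec_fst; apply: rec_id.
Qed.

(** Every number codes an infinite sequence, read off by repeated unpairing. Any function agrees
    with such a sequence on a given initial segment, so a search over numbers covers all maps on a
    finite set. *)
Definition nthc (c i : nat) : nat := fstn (iter i sndn c).

Lemma rec_nthc A F G : rec A F -> rec A G ->
  rec A (fun x => nthc (F x) (G x)).
Proof.
by move=> cF cG; apply: rec_fst; apply: rec_iter => //; apply/rec_snd/rec_id.
Qed.

Lemma nthc_complete (h : nat -> nat) b :
  exists c, forall i, i <= b -> nthc c i = h i.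
Proof.
elim: b h => [|b IH] h.
  by exists (pairn (h 0) 0); case=> //; rewrite /nthc /= fstn_pairn.
have [c hc] := IH (fun i => h i.+1); exists (pairn (h 0) c) => -[|i] lei.
  by rewrite /nthc /= fstn_pairn.
by rewrite /nthc iterSr sndn_pairn; apply: hc.
Qed.

(** * Well-quasi-orders *)

Section WellQuasiOrder.
Variables (X : Type) (R : X -> X -> Prop).

Definition good (s : nat -> X) : Prop := exists i j, i < j /\ R (s i) (s j).

Definition wqo (P : X -> Prop) : Prop :=
  forall s, (forall i, P (s i)) -> good s.

(** Otherwise arbitrarily late terms lie below no term past some bound, and such terms can be
    thinned out to a bad sequence. *)
Lemma wqo_recurrent P s : wqo P -> (forall i, P (s i)) ->
  exists N, forall i, N <= i -> forall m, exists j, m < j /\ R (s i) (s j).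
Proof.
move=> wP Ps; apply: contrapT => /forallNP bad.
have {}bad N : exists i, N <= i /\ exists m, forall j, m < j -> ~ R (s i) (s j).
  have := bad N; rewrite -existsNE => -[i]; rewrite not_implyE => -[Ni].
  rewrite -existsNE => -[m] nm; exists i; split=> //; exists m => j mj Rij.
  by apply: nm; exists j.
have /cid[f fP] : exists f : nat -> nat * nat, forall N,
    N <= (f N).1 /\ forall j, (f N).2 < j -> ~ R (s (f N).1) (s j).
  have /choice[f fP] N : exists p : nat * nat,
      N <= p.1 /\ forall j, p.2 < j -> ~ R (s p.1) (s j).
    by have [i [Ni [m mP]]] := bad N; exists (i, m).
  by exists f.
(* The next index exceeds both the current one and its bound, so no chosen term lies below a later
   chosen one. *)
pose nxt p := f (maxn p.1 p.2).+1 : nat * nat.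
pose u k := iter k nxt (f 0).
have nu k : nxt (u k) = u k.+1 by [].
have uP k j : (u k).2 < j -> ~ R (s (u k).1) (s j).
  by case: k => [|k]; [have [_] := fP 0 | have [_] := fP (maxn (u k).1 (u k).2).+1]; apply.
have umax k l : k < l -> maxn (u k).1 (u k).2 < (u l).1.
  elim: l => // l IH; rewrite ltnS leq_eqVlt => /orP[/eqP->|/IH kl].
    by rewrite -nu; have [] := fP (maxn (u l).1 (u l).2).+1.
  apply: (ltn_trans kl); apply: leq_ltn_trans (leq_maxl _ (u l).2) _.
  by rewrite -nu; have [] := fP (maxn (u l).1 (u l).2).+1.
have [k [l [kl]]] := wP (fun k => s (u k).1) (fun k => Ps _).
by apply: uP; apply: leq_ltn_trans (umax _ _ kl); apply: leq_maxr.
Qed.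

Lemma wqo_chain P s : (forall x y z, R x y -> R y z -> R x z) ->
  wqo P -> (forall i, P (s i)) ->
  exists u : nat -> nat, forall k l, k < l -> u k < u l /\ R (s (u k)) (s (u l)).
Proof.
move=> Rtr wP Ps; have [N rN] := wqo_recurrent wP Ps.
have /choice[f fP] i : exists j, N <= i -> i < j /\ R (s i) (s j).
  case: (leqP N i) => [Ni|]; last by exists 0.
  by have [j jP] := rN i Ni i; exists j.
pose u k := iter k f N.
have uN k : N <= u k.
  by elim: k => //= k IH; apply: (leq_trans IH); have [/ltnW] := fP _ IH.
exists u => k; elim=> // l IH; rewrite ltnS leq_eqVlt => /orP[/eqP->|/IH[ul Rl]].
  exact: fP.
have [? ?] := fP _ (uN l); split; first exact: ltn_trans ul _.
exact: Rtr Rl _.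
Qed.

Variable size_of : X -> nat.

(* Nash-Williams: the terms of a bad sequence are chosen greedily, each of
   least size among those that continue the previous ones to a bad sequence. *)
Lemma minimal_bad_sequence (P : X -> Prop) : ~ wqo P ->
  exists s, [/\ forall i, P (s i), ~ good s
    & forall t n, (forall i, P (t i)) -> ~ good t ->
        (forall i, i < n -> t i = s i) -> size_of (s n) <= size_of (t n)].
Proof.
rewrite -existsNE => -[s0]; rewrite not_implyE => -[Ps0 bad0].
pose bad t := (forall i, P (t i)) /\ ~ good t.
pose ext (n : nat) (s : nat -> X) t := bad t /\ forall i, i < n -> t i = s i.
have /choice[step stepP] (q : nat * (nat -> X)) : exists t, bad q.2 ->
    ext q.1 q.2 t /\
    forall t', ext q.1 q.2 t' -> size_of (t q.1) <= size_of (t' q.1).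
  case: (pselect (bad q.2)) => [bs|]; last by exists q.2.
  have [|m [[t [et <-]] mmin]] :=
    @ex_least (fun m => exists t, ext q.1 q.2 t /\ size_of (t q.1) = m).
    by exists (size_of (q.2 q.1)), q.2.
  exists t => _; split=> // t' et'; rewrite leqNgt; apply/negP => lt.
  by apply: (mmin _ lt); exists t'.
(* [w n] is a bad sequence whose terms before [n] are final; the diagonal [w i.+1 i] is the sequence
   sought. *)
pose w := fix w n := if n is k.+1 then step (k, w k) else s0.
have bw n : bad (w n) by elim: n => //= n /(stepP (n, w n))[[]].
have wS n i : i < n -> w n.+1 i = w n i.
  by move=> lin; have [[_ tE] _] := stepP (n, w n) (bw n); apply: tE.
have wst n k i : i < n -> n <= k -> w k i = w n i.
  move=> ltin; elim: k => [|k IH]; first by rewrite leqn0 => /eqP->.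
  rewrite leq_eqVlt => /orP[/eqP->//|]; rewrite ltnS => nk.
  by rewrite wS ?IH //; apply: leq_trans nk.
exists (fun i => w i.+1 i); split.
- by move=> i; have [] := bw i.+1.
- move=> [i [j [ij Rij]]]; have [_] := bw j.+1; apply; exists i, j; split=> //.
  by rewrite (wst i.+1) // ltnS ltnW.
- move=> t n Pt bt tE; have [_] := stepP (n, w n) (bw n); apply; split=> //= i ltin.
  by rewrite tE // (wst i.+1 n).
Qed.

(** Take a bad sequence of parts, start it where the index of the host term is least, and put it
    behind the first [n i0] terms of [s]. The result is again bad, and its term at [n i0] is smaller
    than minimality of [s] allows. *)
Lemma wqo_parts (P : X -> Prop) (part : X -> X -> Prop) s :
  (forall x y, P x -> part y x -> P y /\ size_of y < size_of x) ->
  (forall x y z, P x -> P z -> part y x -> R z y -> R z x) ->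
  (forall i, P (s i)) -> ~ good s ->
  (forall t n, (forall i, P (t i)) -> ~ good t ->
        (forall i, i < n -> t i = s i) -> size_of (s n) <= size_of (t n)) ->
  wqo (fun y => exists n, part y (s n)).
Proof.
move=> partP Rpart Ps bs smin t /choice[n nP]; apply: contrapT => bt.
have [|m [[i0 <-] mmin]] := @ex_least (fun m => exists i, n i = m).
  by exists (n 0), 0.
pose t' i := if i < n i0 then s i else t (i0 + (i - n i0)).
have Pt i : P (t i) by have [] := partP _ _ (Ps (n i)) (nP i).
have [_ lt] := partP _ _ (Ps (n i0)) (nP i0).
suff : (size_of (s (n i0)) <= size_of (t i0)) by rewrite leqNgt lt.
have := smin t' (n i0); rewrite /t' ltnn subnn addn0; apply.
- by move=> i; case: ifP.
- move=> [i [j [ij]]]; case: (ltnP i (n i0)) => iP; case: (ltnP j (n i0)) => jP Rij.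
  + by apply: bs; exists i, j.
  (* A term of [s] below a part is below the host of that part, whose index is at least [n i0]. *)
  + apply: bs; exists i, (n (i0 + (j - n i0))); split; last exact: Rpart (Rij).
    apply: leq_trans iP _; rewrite leqNgt; apply/negP => lt'.
    by apply: mmin lt' _; exists (i0 + (j - n i0)).
  + by have := leq_trans (ltn_trans ij jP) iP; rewrite ltnn.
  + apply: bt; exists (i0 + (i - n i0)), (i0 + (j - n i0)); split=> //.
    by rewrite ltn_add2l ltn_sub2r // (leq_ltn_trans iP).
- by move=> i ->.
Qed.

End WellQuasiOrder.

(** * Higman's lemma *)

Inductive dominated X (R : X -> X -> Prop) : seq X -> seq X -> Prop :=
| DomNil w : dominated R [::] w
| DomSkip b v w : dominated R v w -> dominated R v (b :: w)
| DomCons a b v w : R a b -> dominated R v w -> dominated R (a :: v) (b :: w).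

(** No word of a minimal bad sequence is empty. Along an ascending chain of first letters the tails
    are taken from a well-quasi-order; two comparable tails with their first letters put back
    contradict badness. *)
Lemma higman (X : eqType) (R : X -> X -> Prop) (P : X -> Prop) :
  (forall x y z, R x y -> R y z -> R x z) ->
  wqo R P -> wqo (dominated R) (fun w => forall x, x \in w -> P x).
Proof.
move=> Rtr wP; apply: contrapT => /(minimal_bad_sequence (@size X))[s [Ps bs smin]].
have /choice[a /choice[v sE]] i : exists a v, s i = a :: v.
  case E: (s i) => [|a v]; last by exists a, v.
  by case: bs; exists i, i.+1; split=> //; rewrite E; constructor.
have [|u uP] := @wqo_chain _ R P a Rtr wP.
  by move=> i; apply: (Ps i); rewrite sE mem_head.
have wB : wqo (dominated R) (fun w => exists n, (exists b, s n = b :: w)).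
  apply: (@wqo_parts _ _ size (fun w => forall x, x \in w -> P x)
    (fun w w' => exists b, w' = b :: w)) Ps bs smin.
  - by move=> x y Px [b xE]; split=> [z zy|];
      [apply: Px; rewrite xE inE zy orbT | rewrite xE].
  - by move=> x y z _ _ [b ->]; apply: DomSkip.
have [i|k [l [kl dkl]]] := wB (v \o u).
  by exists (u i), (a (u i)); apply: sE.
have [ukl Rkl] := uP k l kl.
by apply: bs; exists (u k), (u l); split=> //; rewrite !sE; apply: DomCons.
Qed.

(** The matching of positions becomes an injective map on letters because neither word repeats a
    letter. *)
Lemma dominated_injection (X : eqType) (R : X -> X -> Prop) v w :
  uniq v -> uniq w -> dominated R v w ->
  exists h : X -> X, {in v &, injective h} /\
    forall x, x \in v -> h x \in w /\ R x (h x).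
Proof.
move=> + + dvw; elim: dvw => {v w}
  [w _ _|b v w _ IH uv /= /andP[_ /(IH uv)[h [hi hP]]]
  |a b v w Rab _ IH /= /andP[av uv] /andP[bw /(IH uv)[h [hi hP]]]].
- by exists id.
- by exists h; split=> // x /hP[xw ?]; rewrite inE xw orbT.
exists (fun x => if x == a then b else h x); split=> [x y|x].
- rewrite !inE; case: (eqVneq x a) => [->|xa] /=; case: (eqVneq y a) => [->|ya] //=.
  + by move=> _ /hP[yw _] bE; rewrite bE yw in bw.
  + by move=> /hP[xw _] _ bE; rewrite -bE xw in bw.
  + exact: hi.
- rewrite !inE; case: (eqVneq x a) => [->|xa] /=; first by rewrite eqxx.
  by move=> /hP[-> ?]; rewrite orbT.
Qed.

(** * Trees *)

(** Stated for an arbitrary relation so that it yields both least and greatest elements of finite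
    chains. *)
Lemma bounded_least (R : nat -> nat -> Prop) (Q : nat -> Prop) b :
  (forall x y z, R x y -> R y z -> R x z) ->
  (forall x y, Q x -> Q y -> R x y \/ R y x) ->
  (forall x, Q x -> x < b) -> (exists x, Q x) ->
  exists x, Q x /\ forall y, Q y -> R x y.
Proof.
move=> Rtr; elim: b Q => [|b IH] Q tot bnd [x Qx]; first by have := bnd x Qx.
have Rxx y : Q y -> R y y by move=> Qy; case: (tot y y).
case: (pselect (exists y, Q y /\ y < b)) => [ex|nex].
  have [|y [_ []]//|m [[Qm mb] mmin]] := IH (fun y => Q y /\ y < b) _ _ ex.
    by move=> u v [Qu _] [Qv _]; apply: tot.
  case: (pselect (Q b)) => [Qb|nQb].
    have [mLb|bLm] := tot m b Qm Qb.
      exists m; split=> // y Qy; have := bnd y Qy.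
      by rewrite ltnS leq_eqVlt => /orP[/eqP->//|yb]; apply: mmin.
    exists b; split=> // y Qy; have := bnd y Qy.
    rewrite ltnS leq_eqVlt => /orP[/eqP->|yb]; first exact: Rxx.
    by apply: Rtr bLm _; apply: mmin.
  exists m; split=> // y Qy; apply: mmin; split=> //; have := bnd y Qy.
  by rewrite ltnS leq_eqVlt => /orP[/eqP yb|//]; rewrite yb in Qy.
have Qb y : Q y -> y = b.
  move=> Qy; have := bnd y Qy; rewrite ltnS leq_eqVlt => /orP[/eqP//|yb].
  by case: nex; exists y.
by exists x; split=> // y Qy; rewrite (Qb y Qy) -(Qb x Qx); apply: Rxx.
Qed.

Lemma bounded_choice (P : nat -> nat -> Prop) n :
  exists B, forall y, y <= n -> (exists b, forall z, P y z -> z <= b) ->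
    forall z, P y z -> z <= B.
Proof.
elim: n => [|n [B BP]].
  case: (pselect (exists b, forall z, P 0 z -> z <= b)) => [[b bP]|nb].
    by exists b => y; rewrite leqn0 => /eqP->.
  by exists 0 => y; rewrite leqn0 => /eqP->.
case: (pselect (exists b, forall z, P n.+1 z -> z <= b)) => [[b bP]|nb].
  exists (maxn B b) => y; rewrite leq_eqVlt => /orP[/eqP-> _ z /bP zb|yn yb z Pz].
    by rewrite leq_max zb orbT.
  by rewrite leq_max (BP y).
by exists B => y; rewrite leq_eqVlt => /orP[/eqP-> //|yn]; apply: BP.
Qed.

Section Tree.
(** [L] stands for the tree order restricted to the nodes, so [L n n] says that [n] is a node.
    [Lbnd] expresses the finiteness of the set of nodes below a given one. *)
Variable L : nat -> nat -> Prop.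
Hypothesis Lrefl : forall m n, L m n -> L m m /\ L n n.
Hypothesis Lanti : forall m n, L m n -> L n m -> m = n.
Hypothesis Ltrans : forall m n p, L m n -> L n p -> L m p.
Hypothesis Llin : forall m n p, L m n -> L p n -> L m p \/ L p m.
Hypothesis Lbnd : forall n, exists b, forall m, L m n -> m < b.

Lemma chain_min (Q : nat -> Prop) y : (forall z, Q z -> L z y) ->
  (exists z, Q z) -> exists m, Q m /\ forall z, Q z -> L m z.
Proof.
move=> Qy; have [b bP] := Lbnd y; apply: (bounded_least (b := b)) Ltrans _ _ => //.
  by move=> u v /Qy uy /Qy vy; apply: Llin uy vy.
by move=> x /Qy/bP.
Qed.

Lemma chain_max (Q : nat -> Prop) y : (forall z, Q z -> L z y) ->
  (exists z, Q z) -> exists m, Q m /\ forall z, Q z -> L z m.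
Proof.
move=> Qy; have [b bP] := Lbnd y.
apply: (bounded_least (R := fun u v => L v u) (b := b)) => //.
- by move=> u v w vu wv; apply: Ltrans wv vu.
- by move=> u v /Qy uy /Qy vy; apply: Llin vy uy.
- by move=> x /Qy/bP.
Qed.

(** * Kruskal's theorem for finite trees *)

Section FiniteTrees.
Implicit Types x : nat * seq nat.

(* A pair [(r, F)] stands for the finite tree on the nodes listed by [F], with
   root [r]. *)
Definition fin_tree x : Prop :=
  [/\ x.1 \in x.2, uniq x.2 & forall z, z \in x.2 -> L x.1 z].

(** On a finite tree such a map is injective by antisymmetry. *)
Definition fin_emb x x' : Prop :=
  exists h : nat -> nat, [/\ h x.1 = x'.1, forall z, z \in x.2 -> h z \in x'.2
    & forall u v, u \in x.2 -> v \in x.2 -> L u v <-> L (h u) (h v)].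

Definition child x y : Prop :=
  [/\ y \in x.2, y <> x.1 & forall z, z \in x.2 -> L z y -> z = x.1 \/ z = y].

Definition piece x y := (y, [seq z <- x.2 | `[< L y z >]]).

Definition children x := [seq piece x y | y <- x.2 & `[< child x y >]].

Lemma mem_piece x y z : z \in (piece x y).2 <-> z \in x.2 /\ L y z.
Proof.
rewrite mem_filter; split=> [/andP[/asboolP]|[? ?]] //.
by apply/andP; split=> //; apply/asboolP.
Qed.

Lemma childrenP x p : p \in children x <-> exists y, child x y /\ p = piece x y.
Proof.
split=> [/mapP[y]|[y [cy ->]]].
  by rewrite mem_filter => /andP[/asboolP cy _] ->; exists y.
by apply: map_f; rewrite mem_filter; apply/andP; split; [apply/asboolP | case: cy].
Qed.

Lemma child_below x z : fin_tree x -> z \in x.2 -> z <> x.1 ->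
  exists y, child x y /\ L y z.
Proof.
move=> [rx ux Lx] zx zr; have [_ Lzz] := Lrefl (Lx z zx).
have [||y [[yx yr yz] ymin]] :=
    @chain_min (fun y => [/\ y \in x.2, y <> x.1 & L y z]) z.
- by move=> w [].
- by exists z.
exists y; split=> //; split=> // w wx wy; case: (eqVneq w x.1) => [|/eqP wr]; [by left|right].
by apply: Lanti => //; apply: ymin; split=> //; apply: Ltrans yz.
Qed.

Lemma child_uniq x y y' z : child x y -> child x y' -> L y z -> L y' z -> y = y'.
Proof.
move=> [yx yr ymin] [yx' yr' ymin'] yz yz'; have [yy|yy] := Llin yz yz'.
  by have [] := ymin' y yx yy.
by have [] := ymin y' yx' yy.
Qed.

Lemma fin_tree_piece x y : fin_tree x -> child x y ->
  fin_tree (piece x y) /\ size (piece x y).2 < size x.2.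
Proof.
move=> [rx ux Lx] [yx yr ymin]; split.
  split; last by move=> z /mem_piece[].
    by apply/mem_piece; split=> //; have [] := Lrefl (Lx y yx).
  exact: filter_uniq.
rewrite size_filter -(count_predC (fun z => `[< L y z >]) x.2) -addn1 leq_add2l -has_count.
by apply/hasP; exists x.1 => //; apply/negP => /asboolP/Lanti-/(_ (Lx y yx)).
Qed.

Lemma fin_emb_trans x y z : fin_emb x y -> fin_emb y z -> fin_emb x z.
Proof.
move=> [h [hr hF hL]] [k [kr kF kL]]; exists (k \o h); split=> [|u /hF/kF//|u v ux vx] /=.
  by rewrite hr.
by rewrite hL // kL //; apply: hF.
Qed.

(** The image of [z] lies strictly above the root of [x], so the image of the root of [z] can be
    moved down to the root of [x]. *)
Lemma fin_emb_piece x y z : fin_tree x -> fin_tree z -> child x y ->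
  fin_emb z (piece x y) -> fin_emb z x.
Proof.
move=> [rx ux Lx] [rz _ Lz] [yx yr _] [h [hr hF hL]].
exists (fun w => if w == z.1 then x.1 else h w); rewrite eqxx.
have hx w : w \in z.2 -> h w \in x.2 /\ L y (h w) by move=> /hF/mem_piece.
split=> [//|w wz|u v uz vz]; first by case: ifP => // _; have [] := hx w wz.
case: eqP => [->|ur]; case: eqP => [->|vr].
- by split=> _; [have [] := Lrefl (Lx _ rx) | apply: Lz].
- by split=> _; [apply: Lx; have [] := hx v vz | apply: Lz].
- split=> [/Lanti/(_ (Lz u uz))//|/(Ltrans (hx u uz).2)].
  by move=> /Lanti/(_ (Lx y yx)).
- exact: hL.
Qed.

(** The root goes to the root, and the piece above each child is embedded by its own map. Nodes in
    different pieces are incomparable, and their images are too, because distinct children go to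
    distinct children. *)
Lemma fin_emb_children x x' : fin_tree x -> fin_tree x' ->
  dominated fin_emb (children x) (children x') -> fin_emb x x'.
Proof.
move=> Tx Tx'; have [rx ux Lx] := Tx; have [rx' uqx' Lx'] := Tx'.
have uch z : uniq z.2 -> uniq (children z).
  by move=> uz; rewrite map_inj_uniq ?filter_uniq // => u v [].
move=> /(dominated_injection (uch x ux) (uch x' uqx'))[s [sinj sP]].
have /choice[c cP] y : exists y', child x y ->
    [/\ child x' y', s (piece x y) = piece x' y' & fin_emb (piece x y) (piece x' y')].
  case: (pselect (child x y)) => [cy|]; last by exists 0.
  have [] := sP (piece x y); first by apply/childrenP; exists y.
  by move=> /childrenP[y' [cy' ->]]; exists y'.
have cinj y1 y2 : child x y1 -> child x y2 -> c y1 = c y2 -> y1 = y2.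
  move=> c1 c2 e; have [_ e1 _] := cP y1 c1; have [_ e2 _] := cP y2 c2.
  have /(congr1 fst)// : piece x y1 = piece x y2; apply: sinj.
  - by apply/childrenP; exists y1.
  - by apply/childrenP; exists y2.
  - by rewrite e1 e2 e.
have /choice[k kP] y : exists k : nat -> nat, child x y ->
    (forall z, z \in x.2 -> L y z -> k z \in x'.2 /\ L (c y) (k z)) /\
    (forall u v, u \in x.2 -> v \in x.2 -> L y u -> L y v -> L u v <-> L (k u) (k v)).
  case: (pselect (child x y)) => [cy|]; last by exists id.
  have [_ _ [k [_ kF kL]]] := cP y cy; exists k => _; split.
    by move=> z zx yz; apply/mem_piece/kF/mem_piece.
  by move=> u v ux' vx yu yv; apply: kL; apply/mem_piece.
(* [b z] is the child below [z]; it selects the map to be used at [z]. *)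
have /choice[b bP] z : exists y, z \in x.2 -> z <> x.1 -> child x y /\ L y z.
  case: (pselect (z \in x.2 /\ z <> x.1)) => [[zx zr]|nz]; last by exists 0 => ? ?; case: nz.
  by have [y yP] := child_below Tx zx zr; exists y.
exists (fun z => if z == x.1 then x'.1 else k (b z) z); rewrite eqxx.
have hP z : z \in x.2 -> z <> x.1 -> k (b z) z \in x'.2 /\ L (c (b z)) (k (b z) z).
  by move=> zx zr; have [cb bz] := bP z zx zr; apply: (kP _ cb).1.
split=> [//|z zx|u v uxx vx]; first by case: eqP => // zr; have [] := hP z zx zr.
case: eqP => [->|ur]; case: eqP => [->|vr].
- by split=> _; [apply: Lx' | apply: Lx].
- by split=> _; [apply: Lx'; have [] := hP v vx vr | apply: Lx].
- split=> [/Lanti/(_ (Lx u uxx))//|].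
  have [kx ck] := hP u uxx ur; move=> /Lanti/(_ (Lx' _ kx)) ku.
  have [cb _] := bP u uxx ur; have [[cx cr _] _ _] := cP _ cb.
  by rewrite ku in ck; case: cr; apply: Lanti ck (Lx' _ cx).
- have [cu bu] := bP u uxx ur; have [cv bv] := bP v vx vr.
  case: (eqVneq (b u) (b v)) => [e|/eqP ne].
    by rewrite -e; apply: (kP _ cu).2 => //; rewrite e.
  split=> Luv; case: ne.
    exact: child_uniq cu cv (Ltrans bu Luv) bv.
  have [_ ku] := hP u uxx ur; have [_ kv] := hP v vx vr.
  apply: cinj => //; have [c1 _ _] := cP _ cu; have [c2 _ _] := cP _ cv.
  exact: child_uniq c1 c2 (Ltrans ku Luv) kv.
Qed.

(** The pieces of the terms of a minimal bad sequence are well-quasi-ordered, hence by Higman's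
    lemma so are the lists of such pieces. Two comparable lists assemble to an embedding of the
    whole trees. *)
Lemma kruskal : wqo fin_emb fin_tree.
Proof.
apply: contrapT => /(minimal_bad_sequence (fun x => size x.2))[s [Ps bs smin]].
have wB : wqo fin_emb (fun p => exists n, exists y, child (s n) y /\ p = piece (s n) y).
  apply: (@wqo_parts _ _ (fun x => size x.2) fin_tree
    (fun p x => exists y, child x y /\ p = piece x y)) Ps bs smin.
  - by move=> x _ Tx [y [cy ->]]; apply: fin_tree_piece.
  - by move=> x _ z Tx Tz [y [cy ->]]; apply: fin_emb_piece.
have [i p /childrenP ?|i [j [ij d]]] := higman fin_emb_trans wB (s := children \o s).
  by exists i.
by apply: bs; exists i, j; split=> //; apply: fin_emb_children.
Qed.

End FiniteTrees.

(** * Decidability of the tree predicates *)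

Hypothesis decL : dec set0 (fun p => L (fstn p) (sndn p)).

Lemma dec_L A F G : rec A F -> rec A G ->
  dec A (fun p => L (fstn p) (sndn p)) -> dec A (fun x => L (F x) (G x)).
Proof. by move=> rF rG dL; apply: dec_app2 dL rF rG. Qed.

Let decL2 : dec (jump (jump set0)) (fun p => L (fstn p) (sndn p)).
Proof. by do 2!apply: dec_jump. Qed.

Definition imm p y : Prop :=
  L p y /\ p <> y /\ forall z, L z y -> z = y \/ L z p.

Definition infinite_above x : Prop := forall n, exists m, n < m /\ L x m.

Definition block (s : nat -> nat) k z : Prop := L (s k) z /\ ~ L (s k.+1) z.

Definition block_emb s k l (h : nat -> nat) : Prop :=
  [/\ h (s k) = s l, forall z, block s k z -> block s l (h z)
    & forall u v, block s k u -> block s k v -> (L u v <-> L (h u) (h v))].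

Ltac rec_tac := repeat first [ exact: rec_id | eassumption | exact: rec_const
  | apply: rec_nthc | apply: rec_fst | apply: rec_snd | apply: rec_S | apply: rec_pair ].

Ltac dec_tac := repeat first [ apply: dec_not | apply: dec_and | apply: dec_or
  | apply: dec_iff | apply: dec_imp | apply: dec_le | apply: dec_eq
  | apply: dec_L; last eassumption | rec_tac ].

Lemma dec_imm : dec (jump set0) (fun p => imm (fstn p) (sndn p)).
Proof.
have decL1 := dec_jump decL.
apply: dec_and; first by dec_tac.
apply: dec_and; first by dec_tac.
by apply: (@dec_all _ (fun p z => L z (sndn p) -> z = sndn p \/ L z (fstn p))); dec_tac.
Qed.

(** A universal quantifier over an existential one: each costs one jump above the decidable
    order. *)
Lemma dec_infinite_above : dec (jump (jump set0)) infinite_above.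
Proof.
apply: (@dec_all _ (fun x n => exists m, n < m /\ L x m)).
by apply: (@dec_ex _ (fun p m => sndn p < m /\ L (fstn p) m)); dec_tac.
Qed.

(** * Shifting a sequence of finite blocks *)

Section Shift.
Variables (s : nat -> nat) (U : nat -> Prop) (b : Prop).
Hypothesis rec_s : rec (jump (jump set0)) s.
Hypothesis dec_U : dec (jump (jump set0)) U.
(* The roots [s k] form a chain or an antichain according to [b]. *)
Hypothesis Ls : forall k l, L (s k) (s l) <-> k = l \/ (b /\ k < l).
Hypothesis imm_s : b -> forall k, imm (s k) (s k.+1).
Hypothesis U_block : forall z, U z <-> exists k, block s k z.
Hypothesis block_bounded : forall k, exists B, forall z, block s k z -> z <= B.
(** A node outside the blocks lies above no root, and lies below all roots or none. Hence it keeps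
    its relation to the blocks when these are moved. *)
Hypothesis outside_above : forall w k, ~ U w -> ~ L (s k) w.
Hypothesis outside_below : forall w k l, ~ U w -> L w (s k) -> L w (s l).
Hypothesis block_recurrent :
  forall k m, exists l, m < l /\ exists h, block_emb s k l h.

Let block_root k : block s k (s k).
Proof.
split; first by apply/Ls; left.
by move=> /Ls[/esym/n_Sn//|[_]]; rewrite ltnNge leqnSn.
Qed.

(** The way up from block [k] to a later block passes through [s k.+1], whose parent is [s k]; so
    only the root of block [k] lies below later blocks. This is why block embeddings are to map root
    to root. *)
Let block_cross k l z w : block s k z -> block s l w -> k <> l ->
  (L z w <-> z = s k /\ b /\ k < l).
Proof.
move=> [kz kz'] [lw lw'] kl; split; last first.
  by move=> [-> [bT ltkl]]; apply: Ltrans lw; apply/Ls; right.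
move=> zw; have [slz|zsl] := Llin lw zw.
  have [/Ls[|[bT lk]]|/Ls[|[bT lk]]] := Llin slz kz; try by move=> e; case: kl.
    case: lw'; apply: Ltrans zw; apply: Ltrans kz; apply/Ls.
    by move: lk; rewrite leq_eqVlt => /orP[/eqP|] ?; [left | right].
  case: kz'; apply: Ltrans slz; apply/Ls.
  by move: lk; rewrite leq_eqVlt => /orP[/eqP|] ?; [left | right].
have /Ls[//|[bT ltkl]] := Ltrans kz zsl; split=> //.
have [_ [_ immk]] := imm_s bT k.
have sk'l : L (s k.+1) (s l).
  by apply/Ls; move: ltkl; rewrite leq_eqVlt => /orP[/eqP|] ?; [left | right].
have [//|zsk'] := Llin sk'l zsl.
have [zE|zsk] := immk z zsk'; last exact: Lanti.
by case: kz'; rewrite -zE; have [] := Lrefl kz.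
Qed.

Let block_uniq k l z : block s k z -> block s l z -> k = l.
Proof.
move=> kz lz; case: (eqVneq k l) => // /eqP kl.
have [_ Lzz] := Lrefl kz.1.
have [_ [_ lkl]] := (block_cross kz lz kl).1 Lzz.
have [_ [_ llk]] := (block_cross lz kz (nesym kl)).1 Lzz.
by have := ltn_trans lkl llk; rewrite ltnn.
Qed.

(** The roots are passed as numbers because [s] is computable only from [0'']. The matrix is then
    decidable without oracle, and the two universal quantifiers use up the two jumps. *)
Let block_code t t' w w' c u v :=
  (nthc c t = w /\ (L t u /\ ~ L t' u -> L w (nthc c u) /\ ~ L w' (nthc c u))) /\
  (L t u /\ ~ L t' u -> L t v /\ ~ L t' v -> (L u v <-> L (nthc c u) (nthc c v))).

Let block_codeP k l c :
  (forall u v, block_code (s k) (s k.+1) (s l) (s l.+1) c u v) <->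
  block_emb s k l (nthc c).
Proof.
split=> [H|[H1 H2 H3] u v]; last by split; [split=> // /H2|apply: H3].
by split=> [|u|u v]; [by have [[]] := H 0 0 | have [[_]] := H u 0 | have [_] := H u v].
Qed.

Let dec_block_code : dec (jump (jump set0)) (fun q => forall u v,
  block_code (fstn q) (fstn (sndn q)) (fstn (sndn (sndn q)))
    (fstn (sndn (sndn (sndn q)))) (sndn (sndn (sndn (sndn q)))) u v).
Proof.
apply: (@dec_all _ (fun q u => forall v,
  block_code (fstn q) (fstn (sndn q)) (fstn (sndn (sndn q)))
    (fstn (sndn (sndn (sndn q)))) (sndn (sndn (sndn (sndn q)))) u v)).
apply: (@dec_all _ (fun p =>
  block_code (fstn (fstn p)) (fstn (sndn (fstn p))) (fstn (sndn (sndn (fstn p))))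
    (fstn (sndn (sndn (sndn (fstn p))))) (sndn (sndn (sndn (sndn (fstn p)))))
    (sndn p))).
by rewrite /block_code; dec_tac.
Qed.

Let shift_step x y := sndn x < fstn y /\
  block_emb s (fstn x) (fstn y) (nthc (sndn y)).

Lemma rec_shift : exists g c : nat -> nat,
  [/\ rec (jump (jump set0)) c, forall k, k < g k,
      forall k l, k < l -> g k < g l & forall k, block_emb s k (g k) (nthc (c k))].
Proof.
have [||F [rF FP _]] := @rec_choose (jump (jump set0)) shift_step.
- apply: dec_and; first by apply: dec_lt; rec_tac.
  pose t p := pairn (s (fstn (fstn p))) (pairn (s (fstn (fstn p)).+1)
    (pairn (s (fstn (sndn p))) (pairn (s (fstn (sndn p)).+1) (sndn (sndn p))))).
  have rt : rec (jump (jump set0)) t.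
    by do 4?[apply: rec_pair; first by apply: rec_app rec_s _; rec_tac]; rec_tac.
  apply: dec_ext (dec_app dec_block_code rt) => p.
  by rewrite /t !(fstn_pairn, sndn_pairn) block_codeP.
- move=> x; have [l [ml [h [h1 h2 h3]]]] := block_recurrent (fstn x) (sndn x).
  (* The block is bounded, so a single number [c] codes the embedding on it. *)
  have [B BP] := block_bounded (fstn x); have [c cP] := nthc_complete h B.
  have cE z : block s (fstn x) z -> nthc c z = h z by move=> /BP/cP.
  exists (pairn l c); rewrite /shift_step fstn_pairn sndn_pairn; split=> //; split.
  + by rewrite cE.
  + by move=> z bz; rewrite cE //; apply: h2.
  + by move=> u v bu bv; rewrite !cE //; apply: h3.
(* [G k] packs the target index and the code of the embedding of block [k]. Each search asks for a
   target beyond the previous one, so the targets increase strictly. *)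
pose G k := nat_rect (fun=> nat) (F (pairn 0 0)) (fun k r => F (pairn k.+1 (fstn r))) k.
have rG : rec (jump (jump set0)) G.
  apply: (@rec_nat_rect _ (fun=> F (pairn 0 0)) (fun _ k r => F (pairn k.+1 (fstn r))) id id);
    rec_tac.
  by apply: rec_app rF _; rec_tac.
have G0 := FP (pairn 0 0); have GS k := FP (pairn k.+1 (fstn (G k))).
move: G0 GS; rewrite /shift_step !(fstn_pairn, sndn_pairn) => G0 GS'.
have GS k : fstn (G k) < fstn (G k.+1) /\
    block_emb s k.+1 (fstn (G k.+1)) (nthc (sndn (G k.+1))).
  by have := GS' k; rewrite !(fstn_pairn, sndn_pairn).
exists (fun k => fstn (G k)), (fun k => sndn (G k)); split.
- by rec_tac.
- elim=> [|k IH]; first by have [] := G0.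
  by have [lt _] := GS k; apply: leq_trans lt.
- move=> k; elim=> // l IH; have [lt _] := GS l.
  by rewrite ltnS leq_eqVlt => /orP[/eqP->|/IH/ltn_trans->].
- by case=> [|k]; [have [] := G0 | have [] := GS k].
Qed.

(** The root [s 0] is missed: block [k] lands in block [g k], which is never block 0, and the nodes
    outside the blocks are fixed. *)
Lemma shift : exists f, [/\ rec (jump (jump set0)) f,
  forall z, L z z -> L (f z) (f z),
  forall u v, L u u -> L v v -> (L u v <-> L (f u) (f v))
  & exists y, L y y /\ forall z, L z z -> f z <> y].
Proof.
have [g [c [rc gk gmono gP]]] := rec_shift.
(* For [z] outside [U] the condition holds vacuously, so the search always ends. *)
have [||K [rK KP _]] := @rec_choose (jump (jump set0)) (fun z k => U z -> block s k z).
- apply: dec_imp; first by apply: dec_app dec_U _; rec_tac.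
  apply: dec_and; first by apply: dec_L => //; [apply: rec_app rec_s _|]; rec_tac.
  by apply: dec_not; apply: dec_L => //; [apply: rec_app rec_s _|]; rec_tac.
- move=> z; case: (pselect (U z)) => [/U_block[k]|nU]; [by exists k | by exists 0].
pose f z := if `[< U z >] then nthc (c (K z)) z else z.
have f_block k z : block s k z -> f z = nthc (c k) z /\ block s (g k) (f z).
  move=> kz; have Uz : U z by apply/U_block; exists k.
  rewrite /f asboolT // (block_uniq (KP z Uz) kz); split=> //.
  by have [_ + _] := gP k; apply.
have f_out z : ~ U z -> f z = z by move=> nU; rewrite /f asboolF.
exists f; split.
- apply: rec_if => //; last exact: rec_id.
  by apply: rec_nthc; rec_tac; apply: rec_app rc _.
- move=> z Lzz; case: (pselect (U z)) => [/U_block[k /f_block[_ [/Lrefl[]]]]//|nU].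
  by rewrite f_out.
- move=> u v Luu Lvv.
  case: (pselect (U u)) => [/U_block[k ku]|nUu]; case: (pselect (U v)) => [/U_block[l lv]|nUv].
  + have [fuE fu] := f_block k u ku; have [fvE fv] := f_block l v lv.
    have [fr _ fL] := gP k.
    case: (eqVneq k l) => [e|/eqP kl].
      by rewrite fuE fvE; rewrite -{}e in lv *; apply: fL.
    have gkl : g k <> g l.
      by move=> e; case: (ltngtP k l) kl => [/gmono|/gmono|//]; rewrite e ltnn.
    rewrite (block_cross ku lv kl) (block_cross fu fv gkl).
    have -> : (g k < g l) = (k < l).
      by case: (ltngtP k l) kl => [/gmono + _|/gmono + _|//]; case: ltngtP.
    (* A block embedding is injective by antisymmetry, so only the root of block [k] reaches the
       root of its target. *)
    suff -> : (f u = s (g k)) = (u = s k) by [].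
    apply/propext; split=> [|->]; last by have [-> _] := f_block k _ (block_root k).
    rewrite fuE -fr => e; have L1 := fL u (s k) ku (block_root k).
    have L2 := fL (s k) u (block_root k) ku; rewrite e in L1 L2.
    have Lnn : L (nthc (c k) (s k)) (nthc (c k) (s k)) by rewrite -e; apply/(fL u u).
    by apply: Lanti; [apply/L1 | apply/L2].
  + rewrite (f_out v) //; have [_ [fu _]] := f_block k u ku.
    by split=> [/(Ltrans ku.1)|/(Ltrans fu)] /outside_above.
  + rewrite (f_out u) //; have [_ [fv fv']] := f_block l v lv.
    (* By linearity [u] is comparable with the root of the block in question; not being above it,
       [u] lies below it and hence below every root. *)
    split=> [uv|uv].
      have [/outside_above//|usl] := Llin lv.1 uv.
      by apply: Ltrans fv; apply: outside_below usl.
    have [/outside_above//|usl] := Llin fv uv.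
    by apply: Ltrans lv.1; apply: outside_below usl.
  + by rewrite !f_out.
- exists (s 0); split; first by apply/Ls; left.
  move=> z Lzz; case: (pselect (U z)) => [/U_block[k /f_block[_ kz]] fz|nU].
    rewrite fz in kz; have := block_uniq kz (block_root 0).
    by have := gk k; case: (g k).
  by rewrite f_out // => zE; apply: nU; apply/U_block; exists 0; rewrite zE.
Qed.

End Shift.

(** * Infinite nodes, parents and children *)

Let dec_imm2 F G : rec (jump (jump set0)) F -> rec (jump (jump set0)) G ->
  dec (jump (jump set0)) (fun x => imm (F x) (G x)).
Proof. by move=> rF rG; apply: dec_app2 rF rG; apply/dec_jump/dec_imm. Qed.

Let dec_inf2 F : rec (jump (jump set0)) F ->
  dec (jump (jump set0)) (fun x => infinite_above (F x)).
Proof. by move=> rF; apply: dec_app rF; apply: dec_infinite_above. Qed.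

Lemma infinite_above_refl x : infinite_above x -> L x x.
Proof. by move=> /(_ 0)[m [_ /Lrefl[]]]. Qed.

Lemma not_infinite_aboveP x : ~ infinite_above x <-> exists n, forall m, L x m -> m <= n.
Proof.
split=> [|[n nP] /(_ n)[m [nm /nP]]]; last by rewrite leqNgt nm.
rewrite -existsNE => -[n nP]; exists n => m xm; rewrite leqNgt; apply/negP => nm.
by apply: nP; exists m.
Qed.

Lemma imm_below x z : L x z -> x <> z -> exists y, imm x y /\ L y z.
Proof.
move=> xz nxz; have [_ Lzz] := Lrefl xz.
have [||y [[xy [nxy yz]] ymin]] := @chain_min (fun y => L x y /\ x <> y /\ L y z) z.
- by move=> y [_ []].
- by exists z.
exists y; split=> //; split=> //; split=> // w wy.
have [wx|xw] := Llin wy xy; first by right.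
case: (eqVneq x w) => [->|/eqP xnw]; first by right; have [] := Lrefl wy.
left; apply: (Lanti wy); apply: ymin; split=> //; split=> //.
exact: Ltrans wy yz.
Qed.

Lemma imm_uniq x y y' z : imm x y -> imm x y' -> L y z -> L y' z -> y = y'.
Proof.
have key u v : imm x u -> imm x v -> L u v -> u = v.
  move=> [xu [nxu _]] [_ [_ vmin]] /vmin[//|ux].
  by case: nxu; apply: Lanti.
by move=> iy iy' yz y'z; have [/key->|/key->] := Llin yz y'z.
Qed.

Lemma imm_parent p p' y : imm p y -> imm p' y -> p = p'.
Proof.
move=> [py [npy pmin]] [p'y [np'y p'min]].
have [//|pp'] := p'min _ py; have [e|p'p] := pmin _ p'y; first by case: np'y.
exact: Lanti.
Qed.

(** The nodes below [n] form a finite chain, so a counterexample yields a least one. *)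
Lemma tree_induction (P : nat -> Prop) :
  (forall n, L n n -> (forall m, L m n -> m <> n -> P m) -> P n) ->
  forall n, L n n -> P n.
Proof.
move=> IH n Lnn; apply: contrapT => nPn.
have [||m [[mn nPm] mmin]] := @chain_min (fun m => L m n /\ ~ P m) n.
- by move=> z [].
- by exists n.
apply: nPm; apply: IH => [|k km nkm]; first by have [] := Lrefl mn.
apply: contrapT => nPk; apply: nkm; apply: Lanti => //; apply: mmin.
by split=> //; apply: Ltrans mn.
Qed.

(** Only finitely many children are not infinite, so one bound serves for all their cones. This
    provides an infinite child of an infinite node, and bounds the blocks along a chain. *)
Lemma cone_cover x : (exists n, forall y, imm x y -> ~ infinite_above y -> y <= n) ->
  exists B, forall z, L x z ->
    [\/ x = z, exists y, [/\ imm x y, infinite_above y & L y z] | z <= B].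
Proof.
move=> [n nP]; have [B BP] := bounded_choice L n; exists B => z xz.
case: (eqVneq x z) => [->|/eqP nxz]; first by constructor 1.
have [y [xy yz]] := imm_below xz nxz.
case: (pselect (infinite_above y)) => iy; first by constructor 2; exists y.
constructor 3; apply: BP (nP _ xy iy) _ _ yz.
by have [b bP] := (not_infinite_aboveP y).1 iy; exists b.
Qed.

(** Each block, being bounded, is listed as a finite tree with root [s k]; Kruskal's theorem then
    supplies the number [N] of blocks to discard. *)
Lemma block_recurrent_tail s : (forall k, block s k (s k)) ->
  (forall k, exists B, forall z, block s k z -> z <= B) ->
  exists N, forall k m, exists l, m < l /\
    exists h, block_emb (fun k => s (k + N)) k l h.
Proof.
move=> sk /choice[B BP].
pose t k := (s k, [seq z <- iota 0 (B k).+1 | `[< block s k z >]]).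
have tP k z : z \in (t k).2 <-> block s k z.
  rewrite mem_filter mem_iota add0n ltnS; split=> [/andP[/asboolP]//|kz].
  by apply/andP; split; [apply/asboolP | apply: BP].
have [i|N NP] := wqo_recurrent kruskal (s := t).
  by split; [apply/tP | apply/filter_uniq/iota_uniq | move=> z /tP[]].
exists N => k m; have [l [ml [h [h1 h2 h3]]]] := NP (k + N) (leq_addl _ _) (m + N).
exists (l - N); split; first by rewrite ltn_subRL addnC.
have lE : l - N + N = l by rewrite subnK // ltnW // (leq_ltn_trans _ ml) // leq_addl.
exists h; split=> [|z kz|u v ku kv]; rewrite /= ?lE //.
- rewrite -[block _ _ _]/(block s (l - N + N) (h z)) lE.
  by apply/tP/h2/tP.
- by apply: h3; apply/tP.
Qed.

(** * The three kinds of trees *)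

Definition nontrivial_embedding_rec : Prop := exists f,
  [/\ rec (jump (jump set0)) f,
  forall z, L z z -> L (f z) (f z),
  forall u v, L u u -> L v v -> (L u v <-> L (f u) (f v))
  & exists y, L y y /\ forall z, L z z -> f z <> y].

(** The children of [x] that are not infinite are listed in increasing numerical order. Their cones
    are disjoint, so block [k] is the whole cone of [s k]. *)
Lemma embedding_of_finite_children x :
  (forall n, exists y, n < y /\ imm x y /\ ~ infinite_above y) -> nontrivial_embedding_rec.
Proof.
have dS F : rec (jump (jump set0)) F ->
    dec (jump (jump set0)) (fun p => imm x (F p) /\ ~ infinite_above (F p)).
  by move=> rF; apply: dec_and; [apply: dec_imm2|apply/dec_not/dec_inf2]; rec_tac.
move=> xinf; have [|F [rF FP Fmin]] := @rec_choose (jump (jump set0))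
    (fun n y => n < y /\ imm x y /\ ~ infinite_above y) _ xinf.
  by apply: dec_and; [apply: dec_lt|apply: dS]; rec_tac.
pose s k := iter k F (F 0).
have sP k : imm x (s k) /\ ~ infinite_above (s k) by case: k => [|k]; apply: (FP _).2.
have slt k : s k < s k.+1 by apply: (FP _).1.
have smono k l : k < l -> s k < s l.
  by elim: l => // l IH; rewrite ltnS leq_eqVlt => /orP[/eqP->//|/IH/ltn_trans->].
have sle k l : k <= l -> s k <= s l.
  by rewrite leq_eqVlt => /orP[/eqP->//|/smono/ltnW].
have sinj k l z : L (s k) z -> L (s l) z -> k = l.
  move=> kz lz; have e := imm_uniq (sP k).1 (sP l).1 kz lz.
  by case: (ltngtP k l) => // /smono; rewrite e ltnn.
have sL k : L (s k) (s k) by have [[/Lrefl[]]] := sP k.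
have sblock k z : block s k z <-> L (s k) z.
  split=> [[]|kz] //; split=> // kz'.
  by have := sinj _ _ _ kz kz'; apply: n_Sn.
(* Since [F] returns the least suitable child beyond its argument, none is skipped. *)
have srange N y : s N <= y -> imm x y -> ~ infinite_above y -> exists k, y = s (k + N).
  move=> Ny xy ny.
  have [|k [yk kmin]] := @ex_least (fun k => y < s (k + N)).
    exists y.+1; elim: (y) => [|w IH]; first exact: leq_trans (slt _).
    by apply: leq_ltn_trans IH (slt _).
  case: k yk kmin => [|k yk kmin]; first by rewrite ltnNge Ny.
  exists k; apply/eqP; rewrite eqn_leq; apply/andP; split; last first.
    by rewrite leqNgt; apply/negP/kmin.
  by rewrite leqNgt; apply/negP => lt; apply: (Fmin (s (k + N)) y).
have sbnd k : exists B, forall z, block s k z -> z <= B.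
  by have [B BP] := (not_infinite_aboveP _).1 (sP k).2; exists B => z /sblock/BP.
have [|N NP] := block_recurrent_tail _ sbnd; first by move=> k; apply/sblock.
(* The witness packs a child with a bound on its cone. Asking for the bound, instead of negating
   [infinite_above], keeps the body decidable in [0'], so that the existential quantifier stays
   within [0'']. *)
pose U z := exists p, (s N <= fstn p /\ imm x (fstn p) /\ L (fstn p) z) /\
  forall m, L (fstn p) m -> m <= sndn p.
have UP z : U z <-> exists k, L (s (k + N)) z.
  split=> [[p [[Np [xp pz]] pB]]|[k kz]].
    have [|k e] := srange N _ Np xp; last by exists k; rewrite -e.
    by apply/not_infinite_aboveP; exists (sndn p).
  have [xk /not_infinite_aboveP[B BP]] := sP (k + N).
  exists (pairn (s (k + N)) B); rewrite fstn_pairn sndn_pairn; split=> //.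
  by split=> //; apply: sle; apply: leq_addl.
apply: (@shift (fun k => s (k + N)) U False) => //.
- have rs : rec (jump (jump set0)) s by apply: rec_iter => //; rec_tac.
  rewrite /s; apply: rec_ext (_ : rec _ (fun k => iter k F (s N))) => [k|].
    by rewrite /s iterD.
  by apply: rec_iter => //; rec_tac.
- apply: (@dec_ex _ (fun z p => (s N <= fstn p /\ imm x (fstn p) /\ L (fstn p) z) /\
    forall m, L (fstn p) m -> m <= sndn p)).
  have decL1 := dec_jump decL.
  apply: dec_and.
    apply: dec_and; first by dec_tac.
    apply: dec_and; last by dec_tac.
    by apply: dec_app2 dec_imm _ _; rec_tac.
  by apply: (@dec_all _ (fun q m => L (fstn (sndn q)) m -> m <= sndn (sndn q))); dec_tac.
- move=> k l; split=> [/sinj/(_ (sL _))/eqP|[->|[]]] //.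
  by rewrite eqn_add2r => /eqP; left.
- by move=> z; rewrite UP; split=> -[k /sblock kz]; exists k.
- by move=> k; apply: sbnd.
- by move=> w k nU kw; apply: nU; apply/UP; exists k.
- move=> w k l nU wk; have [[xk [_ kmin]] _] := sP (k + N).
  have [wE|wx] := kmin _ wk; first by case: nU; apply/UP; exists k; rewrite wE.
  by have [[xl _] _] := sP (l + N); apply: Ltrans wx xl.
Qed.

(** Every infinite node has an infinite child, and above [x0] only one, so the search for it traces
    a chain. Block [k] omits the cone of the only infinite child of [s k] and is therefore
    finite. *)
Lemma embedding_of_infinite_chain x0 : infinite_above x0 ->
  (forall a b, infinite_above a -> infinite_above b -> L x0 a -> L x0 b -> L a b \/ L b a) ->
  (forall x, exists n, forall y, imm x y -> ~ infinite_above y -> y <= n) ->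
  nontrivial_embedding_rec.
Proof.
move=> i0 chain fin.
have [||F [rF FP _]] := @rec_choose (jump (jump set0))
    (fun x y => infinite_above x -> imm x y /\ infinite_above y).
- by apply: dec_imp; [apply: dec_inf2|apply: dec_and; [apply: dec_imm2|apply: dec_inf2]]; rec_tac.
- move=> x; case: (pselect (infinite_above x)) => [ix|nix]; last by exists 0.
  (* A node above [x] that exceeds both [B] and [x] can only lie in the cone of an infinite
     child. *)
  have [B BP] := cone_cover (fin x); have [m [Bm /BP[xm|[y [xy iy _]]|]]] := ix (maxn B x).
  + by move: Bm; rewrite -xm ltnNge leq_maxr.
  + by exists y.
  + by rewrite leqNgt (leq_ltn_trans _ Bm) ?leq_maxl.
pose s k := iter k F x0.
have sinf k : infinite_above (s k) by elim: k => //= k /FP[].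
have simm k : imm (s k) (s k.+1) by have [] := FP (s k) (sinf k).
have sL k : L (s k) (s k) by apply: infinite_above_refl.
have smono k l : k <= l -> L (s k) (s l).
  elim: l => [|l IH]; first by rewrite leqn0 => /eqP->.
  rewrite leq_eqVlt => /orP[/eqP->//|/IH kl].
  by apply: Ltrans kl _; have [] := simm l.
have sirr k l : k < l -> ~ L (s l) (s k).
  move=> kl lk; have [kk' [nkk' _]] := simm k; apply: nkk'; apply: Lanti => //.
  exact: Ltrans (smono _ _ kl) lk.
have Ls k l : L (s k) (s l) <-> k = l \/ (True /\ k < l).
  split=> [kl|[->|[_ /ltnW]]] //; last exact: smono.
  by case: (ltngtP k l) kl => [|/sirr//|]; [right | left].
have sbnd k : exists B, forall z, block s k z -> z <= B.
  have [B BP] := cone_cover (fin (s k)); exists (maxn B (s k)) => z [kz nkz].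
  case: (BP z kz) => [<-|[y [ky iy yz]]|zB]; rewrite ?leq_maxr //; last by rewrite leq_max zB.
  case: nkz; suff -> : s k.+1 = y by [].
  have x0k l : L x0 (s l) by apply: (smono 0).
  have [Ly|Ly] := chain (s k.+1) y (sinf _) iy (x0k _) (Ltrans (x0k k) ky.1).
    by apply: imm_uniq (simm k) ky Ly _; apply: infinite_above_refl.
  by apply: imm_uniq (simm k) ky (sL _) Ly.
have [|N NP] := block_recurrent_tail _ sbnd; first by move=> k; split=> //; apply: sirr.
have rs : rec (jump (jump set0)) (fun k => s (k + N)).
  apply: rec_ext (_ : rec _ (fun k => iter k F (s N))) => [k|]; first by rewrite /s iterD.
  by apply: rec_iter => //; rec_tac.
apply: (@shift (fun k => s (k + N)) (fun z => L (s N) z) True) => //.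
- by dec_tac.
- move=> k l; rewrite Ls ltn_add2r.
  by split=> -[|[]] ?; [left; exact: (@addIn N)|right|left; congr addn|right].
- move=> z; split=> [Nz|[k [kz _]]]; last by apply: Ltrans (smono _ _ (leq_addl k N)) kz.
  apply: contrapT => no.
  (* A node of the cone that is in no block would lie above all roots, but the chain below a node
     has a greatest root. *)
  have all k : L (s (k + N)) z.
    elim: k => // k kz; apply: contrapT => nkz; apply: no; exists k; split=> //.
  have [||_ [[k ->] kmax]] := @chain_max (fun w => exists k, w = s (k + N)) z.
  + by move=> _ [k ->].
  + by exists (s (0 + N)), 0.
  + by apply: (@sirr (k + N) (k.+1 + N)) => //; apply: kmax; exists k.+1.
- by move=> k; apply: sbnd.
- by move=> w k nU kw; apply: nU; apply: Ltrans kw; apply: smono; apply: leq_addl.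
- move=> w k l nU wk.
  have Nk j : L (s N) (s (j + N)) by apply: smono; apply: leq_addl.
  by have [wN|//] := Llin wk (Nk k); apply: Ltrans wN _.
Qed.

(** From [x] one keeps stepping to the first node of an incomparable pair and sets the second aside;
    the nodes set aside form the antichain [h x]. Siblings, indexed by their own numbers, thus get
    incomparable images. *)
Lemma embedding_of_perfect r0 : (forall z, L z z -> L r0 z) -> infinite_above r0 ->
  (forall x, infinite_above x -> exists a b,
     [/\ infinite_above a, infinite_above b, L x a /\ L x b & ~ L a b /\ ~ L b a]) ->
  nontrivial_embedding_rec.
Proof.
move=> r0P i0 split_inf.
have [||sp [rsp spP _]] := @rec_choose (jump (jump set0)) (fun x p => infinite_above x ->
    (infinite_above (fstn p) /\ infinite_above (sndn p)) /\ (L x (fstn p) /\ L x (sndn p)) /\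
    (~ L (fstn p) (sndn p) /\ ~ L (sndn p) (fstn p))).
- apply: dec_imp; first by apply: dec_inf2; rec_tac.
  by apply: dec_and; first apply: dec_and; try apply: dec_inf2; dec_tac.
- move=> x; case: (pselect (infinite_above x)) => [ix|nix]; last by exists 0.
  have [a [b [ia ib xab nab]]] := split_inf x ix.
  by exists (pairn a b); rewrite fstn_pairn sndn_pairn.
pose lft x := fstn (sp x); pose h x i := sndn (sp (iter i lft x)).
have lftP x i : infinite_above x -> infinite_above (iter i lft x) /\ L x (iter i lft x).
  move=> ix; elim: i => [|i [ii Li]] /=; first by split=> //; apply: infinite_above_refl.
  have [[il _] [[Ll _] _]] := spP _ ii; split=> //; exact: Ltrans Ll.
have hP x i : infinite_above x -> [/\ infinite_above (h x i), L x (h x i) & x <> h x i].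
  move=> ix; have [ii Li] := lftP x i ix; have [[il ih] [[Ll Lh] [_ nhl]]] := spP _ ii.
  split=> //; first exact: Ltrans Lh.
  by move=> e; apply: nhl; rewrite -/(h x i) -e; apply: Ltrans Ll.
have hlt x i j : infinite_above x -> i < j -> ~ L (h x i) (h x j) /\ ~ L (h x j) (h x i).
  move=> ix ij; have [ii Li] := lftP x i ix; have [[il ih] [_ [nlh nhl]]] := spP _ ii.
  (* Later members of the antichain lie above the first node of the pair chosen at stage [i], which
     is incomparable with [h x i]. *)
  have lj : L (lft (iter i lft x)) (h x j).
    rewrite -iterS -(subnK ij) /h iterD.
    have [ik Lk] := lftP (iter i.+1 lft x) (j - i.+1) il.
    by apply: Ltrans Lk _; have [_ [[]]] := spP _ ik.
  split=> [ij'|ji']; last by apply: nlh; apply: Ltrans ji'.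
  have [] // : L (lft (iter i lft x)) (h x i) \/ L (h x i) (lft (iter i lft x)).
  exact: Llin lj ij'.
have hne x i j : infinite_above x -> i <> j -> ~ L (h x i) (h x j).
  by move=> ix ij; case: (ltngtP i j) ij => [/(hlt x _ _ ix)[]|/(hlt x _ _ ix)[]|].
(* The root counts as its own parent, and a number that is not a node accepts any value, so the
   search always ends. *)
have [||par [rpar parP _]] := @rec_choose (jump (jump set0)) (fun n p => L n n ->
    (n = r0 /\ p = r0) \/ imm p n).
- apply: dec_imp; first by dec_tac.
  by apply: dec_or; [dec_tac | apply: dec_imm2; rec_tac].
- move=> n; case: (pselect (L n n)) => [Lnn|nn]; last by exists 0.
  case: (eqVneq n r0) => [->|/eqP nr]; first by exists r0; left.
  have [||p [[pn npn] pmax]] := @chain_max (fun p => L p n /\ p <> n) n.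
  + by move=> z [].
  + by exists r0; split; [apply: r0P | move=> e; case: nr].
  exists p => _; right; split=> //; split=> // z zn.
  by case: (eqVneq z n) => [|/eqP nzn]; [left | right; apply: pmax].
have imm_r0 p n : imm p n -> n <> r0.
  move=> [pn [npn _]] e; apply: npn; apply: Lanti => //.
  by rewrite e; apply: r0P; have [] := Lrefl pn.
have immL p n : imm p n -> L n n by move=> [/Lrefl[]].
have parE p n : imm p n -> par n = p.
  move=> pn; have [[e _]|pn'] := parP n (immL _ _ pn); first by case: (imm_r0 _ _ pn).
  exact: imm_parent pn' pn.
have [||dep [rdep depP depmin]] := @rec_choose (jump (jump set0)) (fun n d => L n n ->
    iter d par n = r0).
- apply: dec_imp; first by dec_tac.
  by apply: dec_eq; [apply: rec_iter => //|]; rec_tac.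
- move=> n; case: (pselect (L n n)) => [Lnn|nn]; last by exists 0.
  suff [d dP] : exists d, iter d par n = r0 by exists d.
  elim/tree_induction: n / Lnn => n Lnn IH.
  case: (eqVneq n r0) => [->|/eqP nr]; first by exists 0.
  have [[//]|[pn [npn _]]] := parP n Lnn.
  by have [d dP] := IH _ pn npn; exists d.+1; rewrite iterSr.
have depS p n : imm p n -> dep n = (dep p).+1.
  move=> pn; have Lpp : L p p by have [/Lrefl[]] := pn.
  apply/eqP; rewrite eqn_leq; apply/andP; split; rewrite leqNgt; apply/negP.
    by move=> /depmin; apply=> _; rewrite iterSr (parE p n) // depP.
  have := depP n (immL _ _ pn); case: (dep n) => [/(imm_r0 _ _ pn)//|d].
  by rewrite iterSr (parE p n) // => dP /depmin; apply.
have dep0 : dep r0 = 0.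
  by apply/eqP; rewrite -leqn0 leqNgt; apply/negP => /depmin; apply.
pose e0 := sndn (sp r0).
(* [G n k] is the image of the ancestor of [n] at depth [k], so the recursion along a branch becomes
   primitive recursion on depth. It starts with [e0], an infinite node strictly above the root. *)
pose G n k := nat_rect (fun=> nat) e0 (fun k r => h r (iter (dep n - k.+1) par n)) k.
have G_imm p n k : imm p n -> k <= dep p -> G n k = G p k.
  move=> pn; elim: k => //= k IH kp; rewrite IH ?(ltnW kp) //.
  by rewrite (depS p n) // subSS -(subnSK kp) iterSr (parE p n).
pose f n := G n (dep n).
have f0 : f r0 = e0 by rewrite /f dep0.
have f_imm p n : imm p n -> f n = h (f p) n.
  by move=> pn; rewrite /f (depS p n) //= (G_imm p n) // (depS p n) // subnn.
have [[ie0' ie0] [[Le0' Le0] [_ ne0]]] := spP r0 i0.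
have ne0r : r0 <> e0 by move=> e; apply: ne0; rewrite -/e0 -e.
have parent n : L n n -> n <> r0 -> exists p, [/\ imm p n, L p n & p <> n].
  move=> Lnn nr; have [[]//|pn] := parP n Lnn.
  by exists (par n); have [? [? _]] := pn.
have finf n : L n n -> infinite_above (f n).
  move=> Lnn; elim/tree_induction: n / Lnn => n Lnn IH.
  case: (eqVneq n r0) => [->|/eqP nr]; first by rewrite f0.
  have [p [pn Lpn npn]] := parent n Lnn nr; rewrite (f_imm p n) //.
  by have [] := hP (f p) n (IH p Lpn npn).
have fL n : L n n -> L (f n) (f n) by move=> /finf/infinite_above_refl.
have fmono n : L n n -> forall m, L m n -> L (f m) (f n) /\ (m <> n -> f m <> f n).
  move=> Lnn; elim/tree_induction: n / Lnn => n Lnn IH m mn.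
  case: (eqVneq m n) => [->|/eqP nmn]; first by split=> //; apply: fL.
  have nr : n <> r0.
    by move=> e; apply: nmn; apply: Lanti => //; rewrite e; apply: r0P; have [] := Lrefl mn.
  have [p [pn Lpn npn]] := parent n Lnn nr; have [_ [_ pmax]] := pn.
  have [//|mp] := pmax m mn.
  have [fmp _] := IH p Lpn npn m mp.
  have [_ ph nph] := hP (f p) n (finf p (Lrefl Lpn).1); rewrite (f_imm p n) //.
  split=> [|_ e]; first exact: Ltrans ph.
  by apply: nph; apply: Lanti => //; rewrite -e.
have fincomp m n : L m m -> L n n -> ~ L m n -> ~ L n m -> ~ L (f m) (f n).
  move=> Lmm Lnn nmn nnm fmn.
  (* Above the meet [w] the branches to [m] and [n] part through distinct children, whose images
     belong to one antichain. *)
  have [||w [[wm wn] wmax]] := @chain_max (fun w => L w m /\ L w n) m.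
  - by move=> z [].
  - by exists r0; split; apply: r0P.
  have [|m' [wm' m'm]] := imm_below wm; first by move=> e; apply: nmn; rewrite -e.
  have [|n' [wn' n'n]] := imm_below wn; first by move=> e; apply: nnm; rewrite -e.
  have nm'n' : m' <> n'.
    move=> e; have [ww' [nww' _]] := wm'; apply: nww'; apply: Lanti => //.
    by apply: wmax; split=> //; rewrite e.
  have iw : infinite_above (f w) by apply: finf; have [] := Lrefl wm.
  have [fm' _] := fmono m Lmm m' m'm; have [fn' _] := fmono n Lnn n' n'n.
  rewrite (f_imm w m') // in fm'; rewrite (f_imm w n') // in fn'.
  have [] := Llin (Ltrans fm' fmn) fn'; apply: hne => //; exact: nesym.
exists f; split=> //.
- apply: (@rec_nat_rect _ (fun=> e0)
    (fun n k r => h r (iter (dep n - k.+1) par n)) id dep) => //; try by rec_tac.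
  apply: rec_snd.
  apply: (rec_app rsp); apply: rec_iter; rec_tac.
  apply: rec_iter; rec_tac; apply: rec_sub; rec_tac.
  by apply: rec_app rdep _; rec_tac.
- move=> u v Lu Lv; split=> [uv|fuv]; first by have [] := fmono v Lv u uv.
  apply: contrapT => nuv; case: (pselect (L v u)) => [vu|nvu]; last exact: fincomp fuv.
  have [fvu nfvu] := fmono u Lu v vu; apply: nfvu; last exact: Lanti.
  by move=> e; apply: nuv; rewrite e.
- exists r0; split; first exact: infinite_above_refl.
  move=> z Lz fz; apply: ne0r; apply: Lanti => //.
  by have [+ _] := fmono z Lz r0 (r0P z Lz); rewrite f0 fz.
Qed.

Lemma nontrivial_embedding r0 : (forall z, L z z -> L r0 z) -> infinite_above r0 ->
  nontrivial_embedding_rec.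
Proof.
move=> r0P i0.
case: (pselect (forall x, infinite_above x -> exists a b,
     [/\ infinite_above a, infinite_above b, L x a /\ L x b & ~ L a b /\ ~ L b a])) => [perfect|].
  exact: embedding_of_perfect r0P i0 perfect.
rewrite -existsNE => -[x0]; rewrite not_implyE => -[ix0 nsplit].
case: (pselect (exists x, forall n, exists y, n < y /\ imm x y /\ ~ infinite_above y)) => [[x]|nfin].
  exact: embedding_of_finite_children.
apply: embedding_of_infinite_chain ix0 _ _ => [a b ia ib La Lb|x].
  apply: contrapT => nab; apply: nsplit; exists a, b; split=> //.
  by split=> ?; apply: nab; [left | right].
apply: contrapT => nx; apply: nfin; exists x => n; apply: contrapT => ny.
apply: nx; exists n => y xy iy; rewrite leqNgt; apply/negP => lt.
by apply: ny; exists y.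
Qed.

End Tree.

(** * Computable trees *)

Theorem theorem2p3 (T : set nat) (le : nat -> nat -> Prop) :
  computable_tree T le -> infinite_set T ->
  exists f : nat -> nat,
    [/\ self_embedding T le f, nontrivial T f
      & computable_fun_in zero_jump2 T f].
Proof.
case=> -[refl anti trans [r0 Tr0 r0P] fin lin] _ [e ePhi] infT.
pose L m n := [/\ T m, T n & le m n].
have LT n : L n n <-> T n by split=> [[]|Tn] //; split=> //; apply: refl.
have decL : dec set0 (fun p => L (fstn p) (sndn p)).
  (* [ePhi] yields a program for each input separately; all of them have Goedel number [e], so they
     are one program. *)
  have [c ce _] := ePhi 0 I; exists c => p.
  have [c' c'e] := ePhi p I; rewrite (goedel_inj (etrans c'e (esym ce))).
  congr (eval _ _ _ (nat_of_bool _)); apply: asbool_equiv_eq; split.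
    by move=> [m [n [-> Tm Tn mn]]]; rewrite fstn_pairn sndn_pairn.
  by case=> Tm Tn mn; exists (fstn p), (sndn p); rewrite pairn_surj.
have Lbnd n : exists b, forall m, L m n -> m < b.
  case: (pselect (T n)) => [Tn|nTn]; last by exists 0 => m [].
  have /finite_seqP[w wP] := fin n Tn.
  exists (\max_(m <- w) m).+1 => m [Tm _ mn]; rewrite ltnS.
  apply: leq_bigmax_seq => //.
  by have : [set m | T m /\ le m n]%classic m by []; rewrite wP.
have i0 : infinite_above L r0.
  move=> n; apply: contrapT => no; apply: infT.
  apply: (@sub_finite_set _ _ `I_n.+1); last exact: finite_II.
  move=> m Tm /=; rewrite ltnS leqNgt; apply/negP => nm; apply: no.
  by exists m; split=> //; split=> //; apply: r0P.
have [||||z /LT Tz|f [[c cf] fT fL [y [/LT Ty fy]]]] :=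
    @nontrivial_embedding L _ _ _ _ Lbnd decL r0 _ i0.
- by move=> m n [Tm Tn _]; split; apply/LT.
- by move=> m n [Tm Tn mn] [_ _ nm]; apply: anti.
- by move=> m n p [Tm Tn mn] [_ Tp np]; split=> //; apply: trans np.
- move=> m n p [Tm Tn mn] [Tp _ pn].
  by have [] := lin n m p Tn Tm Tp mn pn; [left | right].
- by split=> //; apply: r0P.
have fTT z : T z -> T (f z) by move=> /LT/fT/LT.
exists f; split.
- split=> [|u v /set_mem Tu /set_mem Tv fuv|u v Tu Tv]; first exact: fTT.
    have [/LT Lu /LT Lv] := (Tu, Tv); have /LT Lfu := fTT u Tu.
    have [_ /(_ _)[|_ _ uv]] := fL u v Lu Lv; first by rewrite -fuv.
    have [_ /(_ _)[|_ _ vu]] := fL v u Lv Lu; first by rewrite -fuv.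
    exact: anti.
  have := fL u v ((LT u).2 Tu) ((LT v).2 Tv).
  have [fu fv] := (fTT u Tu, fTT v Tv).
  move=> [L1 L2]; split=> [uv|fuv].
    by case: (L1 (And3 Tu Tv uv)).
  by case: (L2 (And3 fu fv fuv)).
- by move=> /(_ y Ty)[z /LT Tz]; apply: fy.
- by exists (goedel c) => n _; exists c.
Qed.
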